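(* Let $m$ be a positive integer, and let $\Gamma_m=\mathbb{H}\setminus\mathbb{G}/\mathbb{H}$ be the set of double cosets, where $\mathbb{G}=\varinjlim \mathrm{Aut}(F_n)$ and $\mathbb{H}=\mathbb{H}_m\subset\mathbb{G}$ is the stabilizer of the first $m$ generators. For $g,h\in\mathbb{G}$ let $g\circ h\in\Gamma_m$ be the eventual value, for large $j$, of the sequence of double cosets $\mathbb{H}\cdot g\,\theta_j\,h\cdot\mathbb{H}$. Then: (a) The double coset $g\circ h$ depends only on the double cosets $\mathbb{H}g\mathbb{H}$ and $\mathbb{H}h\mathbb{H}$ containing $g$ and $h$ (so $\circ$ is a well-defined binary operation on $\Gamma_m$). (b) The operation $\circ$ on $\Gamma_m$ is associative.
   Context: $F_n$ is the free group on generators $x_1,\dots,x_n$, and $F_\infty=\varinjlim F_n$ is the free group on countably many generators $x_1,x_2,\dots$. $\mathbb{G}=\varinjlim\mathrm{Aut}(F_n)$ is the inductive limit; concretely, $\mathbb{G}$ is the group of automorphisms $g$ of $F_\infty$ for which there is an $n$ such that $g$ restricts to an automorphism of $F_n=\langle x_1,\dots,x_n\rangle$ and $g(x_i)=x_i$ for all $i>n$. The product in $\mathbb{G}$ is composition of maps, $(gh)(w)=g(h(w))$. $\mathbb{H}=\mathbb{H}_m\subset\mathbb{G}$ is the subgroup of all $g\in\mathbb{G}$ with $g(x_i)=x_i$ for $1\le i\le m$. The group $S_\infty$ of finitely supported permutations of $\{1,2,\dots\}$ embeds in $\mathbb{G}$ by permuting the generators. $\theta_j=\theta_j[m]\in S_\infty$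 is the involution that fixes $1,\dots,m$, interchanges $m+i$ with $m+j+i$ for $1\le i\le j$, and fixes all indices greater than $m+2j$; it is regarded as an element of $\mathbb{H}\subset\mathbb{G}$. For fixed $g,h\in\mathbb{G}$, the sequence of double cosets $\mathbb{H}\, g\theta_j h\,\mathbb{H}$ ($j=1,2,\dots$) is eventually constant. *)

(* Defs.v *)
From HB Require Import structures.
From mathcomp Require Import all_boot zify.
From mathcomp Require Import boolp classical_sets.

Set Implicit Arguments.
Unset Strict Implicit.
Unset Printing Implicit Defensive.

Local Open Scope classical_set_scope.
Local Open Scope group_scope.

(* The free group on T, as the type of reduced words. The letter (t, true)    *)
(* stands for t^-1.                                                           *)

Section Words.
Variable T : eqType.
Implicit Types (l : T * bool) (s t : seq (T * bool)).

Definition flip l := (l.1, ~~ l.2).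

Definition reduced s := sorted (fun l l' => l' != flip l) s.

Definition push l s :=
  if s is l' :: s' then if l' == flip l then s' else l :: s else [:: l].

Definition word_mul s t := foldr push t s.

Definition word_inv s := rev (map flip s).

Lemma flipK : involutive flip.
Proof. by case=> a b; rewrite /flip /= negbK. Qed.

Lemma reduced_behead l s : reduced (l :: s) -> reduced s.
Proof. exact: path_sorted. Qed.

Lemma push_reduced l s : reduced s -> reduced (push l s).
Proof.
case: s => [//|l' s]; rewrite /push; case: eqP => [_ /reduced_behead //|/eqP ne].
by move=> r; rewrite /reduced /= ne.
Qed.

Lemma push_cons l s : reduced (l :: s) -> push l s = l :: s.
Proof. by case: s => [//|l' s] /= /andP[/negbTE ->]. Qed.

Lemma pushK l s : reduced s -> push l (push (flip l) s) = s.
Proof.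
case: s => [_|l' s]; rewrite /= ?flipK ?eqxx //.
by case: eqP => [->|_] r; [rewrite push_cons|rewrite /= eqxx].
Qed.

Lemma word_mul_reduced s t : reduced t -> reduced (word_mul s t).
Proof. by move=> rt; elim: s => //= l s; apply: push_reduced. Qed.

Lemma word_mul_push l s t : reduced t ->
  word_mul (push l s) t = push l (word_mul s t).
Proof.
move=> rt; case: s => [//|l' s] /=; case: eqP => [->|//].
by rewrite pushK //; apply: word_mul_reduced.
Qed.

Lemma word_mulA r s t : reduced t ->
  word_mul r (word_mul s t) = word_mul (word_mul r s) t.
Proof. by move=> rt; elim: r => //= l r ->; rewrite word_mul_push. Qed.

Lemma word_mul1 s : reduced s -> word_mul s [::] = s.
Proof.
elim: s => //= l s IH r; rewrite IH ?push_cons //; exact: reduced_behead r.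
Qed.

Lemma word_invK : involutive word_inv.
Proof.
by move=> s; rewrite /word_inv map_rev revK -map_comp map_id_in // => l _; exact: flipK.
Qed.

Lemma word_inv_reduced s : reduced s -> reduced (word_inv s).
Proof.
rewrite /reduced /word_inv rev_sorted sorted_map; apply: sub_sorted => l l'.
by apply: contraNneq => /= /(can_inj flipK) ->; rewrite flipK.
Qed.

Lemma word_mulV s : reduced s -> word_mul (word_inv s) s = [::].
Proof.
elim: s => // l s IH r; rewrite /word_inv /= rev_cons /word_mul foldr_rcons /=.
by rewrite flipK eqxx; apply: IH; exact: reduced_behead r.
Qed.

End Words.

Section FreeGroup.
Variable T : choiceType.

Record free_group := FreeGroup { word :> seq (T * bool); wordP : reduced word }.

HB.instance Definition _ := [isSub for word].
HB.instance Definition _ := [Choice of free_group by <:].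

Implicit Types v w : free_group.

Definition fg_one := FreeGroup (isT : reduced ([::] : seq (T * bool))).
Definition fg_mul v w := FreeGroup (word_mul_reduced v (wordP w)).
Definition fg_inv w := FreeGroup (word_inv_reduced (wordP w)).

Fact fg_mulA : associative fg_mul.
Proof. by move=> u v w; apply: val_inj; apply: word_mulA; exact: wordP. Qed.

Fact fg_mul1 : left_id fg_one fg_mul.
Proof. by move=> w; apply: val_inj. Qed.

Fact fg_mulr1 : right_id fg_one fg_mul.
Proof. by move=> w; apply: val_inj; apply: word_mul1; exact: wordP. Qed.

Fact fg_mulV : left_inverse fg_one fg_inv fg_mul.
Proof. by move=> w; apply: val_inj; apply: word_mulV; exact: wordP. Qed.

Fact fg_mulrV : right_inverse fg_one fg_inv fg_mul.
Proof.
move=> w; rewrite -[X in fg_mul X](_ : fg_inv (fg_inv w) = w) ?fg_mulV //.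
by apply: val_inj; exact: word_invK.
Qed.

HB.instance Definition _ := isGroup.Build free_group
  fg_mulA fg_mul1 fg_mulr1 fg_mulV fg_mulrV.

Definition fg_gen (t : T) : free_group :=
  FreeGroup (isT : reduced [:: (t, false)]).

(* The universal property: any map from T to a group G extends uniquely to a  *)
(* morphism fg_lift.                                                          *)
Definition fg_lift (G : groupType) (f : T -> G) (w : free_group) : G :=
  \prod_(l <- word w) (if l.2 then (f l.1)^-1 else f l.1).

Lemma fg_lift_gen (G : groupType) (f : T -> G) t : fg_lift f (fg_gen t) = f t.
Proof. by rewrite /fg_lift big_seq1. Qed.

Lemma fg_liftM (G : groupType) (f : T -> G) : {morph fg_lift f : v w / v * w}.
Proof.
move=> [v rv] [w rw]; rewrite /fg_lift /= {rv rw}.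
elim: v => [|l v IH]; first by rewrite big_nil mul1g.
rewrite /= big_cons -mulgA -IH; case: (word_mul v w) => [|l' s] /=.
  by rewrite big_seq1 big_nil mulg1.
case: eqP => [->|_]; last by rewrite big_cons.
rewrite big_cons /=; case: l => t [] /=; first by rewrite mulKg.
by rewrite mulVKg.
Qed.

Definition subgroup (G : groupType) (K : set G) :=
  K 1 /\ forall x y, K x -> K y -> K (x * y^-1).

Definition generated (G : groupType) (S : set G) : set G :=
  \bigcap_(K in [set K | subgroup K /\ S `<=` K]) K.

Lemma generated_sub (G : groupType) (S K : set G) :
  subgroup K -> S `<=` K -> generated S `<=` K.
Proof. by move=> sK SK x /(_ K); apply. Qed.

Lemma sub_generated (G : groupType) (S : set G) : S `<=` generated S.
Proof. by move=> x Sx K [_]; apply. Qed.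

Lemma generated_subgroup (G : groupType) (S : set G) : subgroup (generated S).
Proof.
split=> [K [[K1 _] _] //|x y Sx Sy K PK].
by have [[_ KM] _] := PK; apply: KM; [apply: Sx|apply: Sy].
Qed.

Lemma subgroupV (G : groupType) (K : set G) x : subgroup K -> K x -> K x^-1.
Proof. by case=> K1 KM Kx; rewrite -[x^-1]mul1g; exact: KM. Qed.

Lemma subgroupM (G : groupType) (K : set G) x y :
  subgroup K -> K x -> K y -> K (x * y).
Proof.
by move=> sK Kx Ky; rewrite -[y]invgK; apply: sK.2 => //; exact: subgroupV.
Qed.

Lemma generated_gen : generated (range fg_gen) = [set: free_group].
Proof.
apply/seteqP; split=> // w _; case: w => w; elim: w => [|l w IH] rw.
  rewrite (_ : FreeGroup rw = 1); last exact: val_inj.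
  exact: (generated_subgroup _).1.
have lP : generated (range fg_gen) (FreeGroup (isT : reduced [:: l])).
  case: l rw => t [] rw; last by apply: sub_generated; exists t => //; exact: val_inj.
  rewrite (_ : FreeGroup _ = (fg_gen t)^-1); last exact: val_inj.
  apply: (subgroupV (@generated_subgroup _ _)).
  by apply: sub_generated; exists t.
rewrite (_ : FreeGroup rw =
  FreeGroup (isT : reduced [:: l]) * FreeGroup (reduced_behead rw)).
  exact: (subgroupM (@generated_subgroup _ _) lP (IH _)).
by apply: val_inj; rewrite /= push_cons.
Qed.

Lemma morph1 (G G' : groupType) (f : G -> G') :
  {morph f : x y / x * y} -> f 1 = 1.
Proof. by move=> fM; apply: (mulgI (f 1)); rewrite -fM !mulg1. Qed.

Lemma morphV (G G' : groupType) (f : G -> G') :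
  {morph f : x y / x * y} -> {morph f : x / x^-1}.
Proof.
by move=> fM x; apply: (mulgI (f x)); rewrite -fM !mulgV; exact: morph1.
Qed.

Lemma fg_morph_eq (G : groupType) (f f' : free_group -> G) :
  {morph f : x y / x * y} -> {morph f' : x y / x * y} ->
  (forall t, f (fg_gen t) = f' (fg_gen t)) -> f = f'.
Proof.
move=> fM fM' e; apply/funext => w.
have : generated (range fg_gen) w by rewrite generated_gen.
apply: (@generated_sub _ _ [set w | f w = f' w]) => [|_ [t _ <-]]; last exact: e.
split=> [|x y /= ex ey]; first by rewrite /= !morph1.
by rewrite fM fM' ex (morphV fM) (morphV fM') ey.
Qed.

End FreeGroup.

(* Generators are indexed from 0: x_ i is the (i+1)-st generator, so that      *)
(* Fn n is generated by x_ 0, ..., x_ (n-1), and theta m j swaps m + i with   *)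
(* m + j + i for 0 <= i < j.                                                  *)
Definition Finf := free_group nat.
HB.instance Definition _ := Group.on Finf.

Definition x_ (i : nat) : Finf := fg_gen i.

Definition Fn (n : nat) : set Finf := generated [set x_ i | i in [set i | i < n]].

Definition supported_on (n : nat) (g : Finf -> Finf) :=
  g @` Fn n = Fn n /\ forall i, n <= i -> g (x_ i) = x_ i.

Definition in_GG (g : Finf -> Finf) :=
  [/\ bijective g, {morph g : v w / v * w} & exists n, supported_on n g].

Record GG := MkGG { aut :> Finf -> Finf; autP : in_GG aut }.

Lemma GG_inj (g h : GG) : (g : Finf -> Finf) = h -> g = h.
Proof.
case: g h => [g gP] [h hP] /= e.
by move: gP hP; rewrite e => gP hP; rewrite (Prop_irrelevance gP hP).
Qed.

Lemma supported_le n n' (g : Finf -> Finf) : {morph g : v w / v * w} ->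
  n <= n' -> supported_on n g -> supported_on n' g.
Proof.
move=> gM le [gF gi]; split=> [|i ni]; last by apply: gi; exact: leq_trans ni.
have sub : Fn n `<=` Fn n'.
  apply: generated_sub; first exact: generated_subgroup.
  by move=> _ [i /= lt <-]; apply: sub_generated; exists i => //=; exact: leq_trans le.
have memx i : i < n' -> Fn n' (x_ i) by move=> lt; apply: sub_generated; exists i.
apply/seteqP; split.
  suff : Fn n' `<=` g @^-1` Fn n' by move=> s _ [w Fw <-]; exact: s.
  apply: generated_sub.
    split=> [|v w /= Fv Fw]; first by rewrite /= morph1 //; exact: (generated_subgroup _).1.
    by rewrite gM (morphV gM); apply: (generated_subgroup _).2.
  move=> _ [i /= lt <-]; have [ni|ltn] := leqP n i; first by rewrite gi //; exact: memx.
  by apply: sub; rewrite -gF; exists (x_ i) => //; apply: sub_generated; exists i.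
apply: generated_sub.
  split=> [|_ _ [v Fv <-] [w Fw <-]].
    by exists 1; [exact: (generated_subgroup _).1|exact: morph1].
  by exists (v * w^-1); [exact: (generated_subgroup _).2|rewrite gM (morphV gM)].
move=> _ [i /= lt <-]; have [ni|ltn] := leqP n i.
  by exists (x_ i); [exact: memx|exact: gi].
have : Fn n (x_ i) by apply: sub_generated; exists i.
by rewrite -gF => -[w Fw <-]; exists w => //; exact: sub.
Qed.

Fact in_GG_one : in_GG id.
Proof. by split=> //; [exists id|exists 0; split=> //; rewrite image_id]. Qed.

Fact in_GG_mul (g h : GG) : in_GG (g \o h).
Proof.
case: g h => [g [gb gM [n gn]]] [h [hb hM [n' hn]]] /=; split.
- exact: bij_comp.
- by move=> v w /=; rewrite hM gM.
exists (maxn n n').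
have [gF gi] := supported_le gM (leq_maxl n n') gn.
have [hF hi] := supported_le hM (leq_maxr n n') hn.
by split=> [|i ni /=]; [rewrite -image_comp hF gF|rewrite hi ?gi].
Qed.

Definition aut_inv (g : Finf -> Finf) (w : Finf) : Finf :=
  xget 1 [set v | g v = w].

Lemma aut_invK (g : GG) : cancel (aut_inv g) g.
Proof.
move=> w; have [[g' _ gK] _ _] := autP g.
by apply: (@xgetPex _ 1 [set v | g v = w]); exists (g' w); exact: gK.
Qed.

Lemma autK (g : GG) : cancel g (aut_inv g).
Proof.
by have [gb _ _] := autP g; move=> w; apply: (bij_inj gb); rewrite aut_invK.
Qed.

Fact in_GG_inv (g : GG) : in_GG (aut_inv g).
Proof.
have [gb gM [n [gF gi]]] := autP g; split.
- exists g; [exact: aut_invK|exact: autK].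
- by move=> v w; apply: (bij_inj gb); rewrite gM !aut_invK.
exists n; split=> [|i ni]; last by rewrite -{1}(gi i ni) autK.
rewrite -[in LHS]gF image_comp (_ : aut_inv g \o g = id) ?image_id //.
by apply/funext => w /=; rewrite autK.
Qed.

Definition GG_one := MkGG in_GG_one.
Definition GG_mul (g h : GG) := MkGG (in_GG_mul g h).
Definition GG_inv (g : GG) := MkGG (in_GG_inv g).

Fact GG_mulA : associative GG_mul.
Proof. by move=> f g h; apply: GG_inj. Qed.

Fact GG_mul1 : left_id GG_one GG_mul.
Proof. by move=> g; apply: GG_inj. Qed.

Fact GG_mulr1 : right_id GG_one GG_mul.
Proof. by move=> g; apply: GG_inj. Qed.

Fact GG_mulV : left_inverse GG_one GG_inv GG_mul.
Proof. by move=> g; apply: GG_inj; apply/funext => w /=; exact: autK. Qed.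

Fact GG_mulrV : right_inverse GG_one GG_inv GG_mul.
Proof. by move=> g; apply: GG_inj; apply/funext => w /=; exact: aut_invK. Qed.

HB.instance Definition _ := gen_eqMixin GG.
HB.instance Definition _ := gen_choiceMixin GG.
HB.instance Definition _ := isGroup.Build GG
  GG_mulA GG_mul1 GG_mulr1 GG_mulV GG_mulrV.

Lemma GG_mulE (g h : GG) w : (g * h) w = g (h w).
Proof. by []. Qed.

Lemma GG_ext (g h : GG) : (forall i, g (x_ i) = h (x_ i)) -> g = h.
Proof.
have [_ gM _] := autP g; have [_ hM _] := autP h.
by move=> e; apply/GG_inj/fg_morph_eq.
Qed.

Definition HH (m : nat) : set GG :=
  [set g : GG | forall i, i < m -> g (x_ i) = x_ i].

Definition dcoset (m : nat) (g : GG) : set GG :=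
  [set a * g * b | a in HH m & b in HH m].

Definition Gamma (m : nat) : Type := set_type (range (dcoset m)).
HB.instance Definition _ m := Choice.on (Gamma m).

Definition cls (m : nat) (g : GG) : Gamma m :=
  SigSub (mem_set (imageT (dcoset m) g)).

Definition finitary (s : nat -> nat) :=
  bijective s /\ exists n, forall i, n <= i -> s i = i.

Definition perm_fun (s : nat -> nat) : Finf -> Finf := fg_lift (x_ \o s).

Lemma perm_fun_x s i : perm_fun s (x_ i) = x_ (s i).
Proof. exact: fg_lift_gen. Qed.

Lemma perm_fun_comp s t : perm_fun (s \o t) = perm_fun s \o perm_fun t.
Proof.
apply: fg_morph_eq => [||i]; first exact: fg_liftM.
  by move=> v w /=; rewrite {2}/perm_fun fg_liftM /perm_fun fg_liftM.
by rewrite /= !perm_fun_x.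
Qed.

Lemma perm_fun_id s : s =1 id -> perm_fun s = id.
Proof.
by move=> e; apply: fg_morph_eq => // [|i]; [exact: fg_liftM|rewrite perm_fun_x e].
Qed.

Fact perm_in_GG s : finitary s -> in_GG (perm_fun s).
Proof.
move=> [sb [n sn]]; have [t st ts] := sb.
have K : cancel (perm_fun s) (perm_fun t).
  by move=> w; rewrite -[LHS]/((_ \o _) w) -perm_fun_comp perm_fun_id.
have K' : cancel (perm_fun t) (perm_fun s).
  by move=> w; rewrite -[LHS]/((_ \o _) w) -perm_fun_comp perm_fun_id.
split; [by exists (perm_fun t)|exact: fg_liftM|].
have sub u : (forall i, i < n -> u i < n) -> Fn n `<=` perm_fun u @^-1` Fn n.
  move=> ui; apply: generated_sub; last first.
    move=> _ [i /= lt <-]; rewrite perm_fun_x.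
    by apply: sub_generated; exists (u i) => //=; exact: ui.
  have uM : {morph perm_fun u : v w / v * w} := @fg_liftM _ _ _.
  split=> [|v w /= Fv Fw]; first by rewrite /= morph1 //; exact: (generated_subgroup _).1.
  by rewrite uM (morphV uM); apply: (generated_subgroup _).2.
have lts i : i < n -> s i < n.
  move=> lt; rewrite ltnNge; apply/negP => ge.
  by have /(bij_inj sb) e := sn _ ge; move: lt; rewrite ltnNge -e ge.
have ltt i : i < n -> t i < n.
  move=> lt; rewrite ltnNge; apply/negP => ge.
  by have := sn _ ge; rewrite ts => e; move: lt; rewrite ltnNge e ge.
exists n; split=> [|i ni]; last by rewrite perm_fun_x sn.
apply/seteqP; split=> [_ [w Fw <-]|w Fw]; first exact: sub Fw.
by exists (perm_fun t w); [exact: sub Fw|exact: K'].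
Qed.

Definition permG s (sP : finitary s) : GG := MkGG (perm_in_GG sP).

Definition theta_fun (m j i : nat) : nat :=
  if i < m then i
  else if i < m + j then i + j
  else if i < m + j + j then i - j
  else i.

(* Splits on the innermost comparisons first. *)
Local Ltac case_ltn := repeat match goal with
  |- context [leq (S ?a) ?b] =>
    lazymatch a with
    | context [if _ then _ else _] => fail
    | _ => case: (ltnP a b) => ? /=
    end end.

Lemma theta_funK m j : involutive (theta_fun m j).
Proof.
by move=> i; rewrite /theta_fun; case_ltn; lia.
Qed.

Lemma theta_finitary m j : finitary (theta_fun m j).
Proof.
split; first exact: inv_bij (theta_funK m j).
by exists (m + j + j) => i h; rewrite /theta_fun; case_ltn; lia.
Qed.

Definition theta (m j : nat) : GG := permG (theta_finitary m j).

Lemma HH1 m : HH m 1.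
Proof. by []. Qed.

Lemma HHM m a b : HH m a -> HH m b -> HH m (a * b).
Proof. by move=> Ha Hb i lt; rewrite GG_mulE Hb // Ha. Qed.

Lemma HHV m a : HH m a -> HH m a^-1.
Proof. by move=> Ha i lt; rewrite -[in LHS](Ha i lt) -GG_mulE mulVg. Qed.

Lemma cls_mul m a g b : HH m a -> HH m b -> cls m (a * g * b) = cls m g.
Proof.
move=> Ha Hb; apply: val_inj => /=; apply/seteqP; split=> _ [c Hc [d Hd <-]].
  exists (c * a); first exact: HHM.
  by exists (b * d); [exact: HHM|rewrite !mulgA].
exists (c * a^-1); first by apply: HHM => //; exact: HHV.
exists (b^-1 * d); first by apply: HHM => //; exact: HHV.
by rewrite -!mulgA mulKg (mulgA b) mulgV mul1g.
Qed.

Lemma perm_commute n (g : GG) s (sP : finitary s) :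
  supported_on n g -> (forall i, i < n -> s i = i) ->
  permG sP * g = g * permG sP.
Proof.
move=> [gF gi] si; have [[t st ts] _] := sP; apply: GG_ext => i.
rewrite !GG_mulE /= perm_fun_x; have [ni|lt] := leqP n i.
  rewrite gi // perm_fun_x gi // leqNgt; apply/negP => lt.
  by have /(can_inj st) e := si _ lt; move: lt; rewrite e ltnNge ni.
rewrite si //; have : Fn n (g (x_ i)).
  by rewrite -gF; exists (x_ i) => //; apply: sub_generated; exists i.
apply: (@generated_sub _ _ [set w | perm_fun s w = w]); last first.
  by move=> _ [k /= lk <-]; rewrite perm_fun_x si.
have sM : {morph perm_fun s : v w / v * w} := @fg_liftM _ _ _.
split=> [|v w /= ev ew]; first exact: morph1.
by rewrite sM (morphV sM) ev ew.
Qed.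

Lemma theta_stable m k j : k <= j ->
  exists s (sP : finitary s) t (tP : finitary t),
    [/\ forall i, i < m + k -> s i = i, forall i, i < m + k -> t i = i
      & theta m j = permG sP * theta m k * permG tP].
Proof.
move=> kj.
(* t swaps the blocks [m+k, m+j) and [m+j, m+j+k) *)
pose t i := if i < m + k then i else if i < m + j then i + k
  else if i < m + j + k then i - (j - k) else i.
pose u i := if i < m + k then i else if i < m + k + k then i + (j - k)
  else if i < m + j + k then i - k else i.
have tu : cancel t u.
  by move=> i; rewrite /t /u; case_ltn; lia.
have ut : cancel u t.
  by move=> i; rewrite /t /u; case_ltn; lia.
have tP : finitary t.
  split; first by exists u.
  by exists (m + j + k) => i; rewrite /t; case_ltn; lia.
pose s := theta_fun m j \o u \o theta_fun m k.
have sP : finitary s.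
  split.
    apply: bij_comp; last exact: inv_bij (theta_funK m k).
    apply: bij_comp; first exact: inv_bij (theta_funK m j).
    by exists t.
  by exists (m + j + j + k) => i; rewrite /s /theta_fun /u /=; case_ltn; lia.
exists s, sP, t, tP; split.
- by move=> i; rewrite /s /theta_fun /u /=; case_ltn; lia.
- by move=> i; rewrite /t => ->.
apply: GG_ext => i; rewrite !GG_mulE /= !perm_fun_x /s /=.
by rewrite theta_funK tu.
Qed.

Lemma dcoset_eventually_constant m g h :
  exists D : Gamma m, exists N, forall j, N <= j ->
    cls m (g * theta m j * h) = D.
Proof.
have [_ gM [n gn]] := autP g; have [_ hM [n' hn]] := autP h.
pose k := maxn n n'.
have /(supported_le gM) /(_ gn) gk : n <= m + k by rewrite /k; lia.
have /(supported_le hM) /(_ hn) hk : n' <= m + k by rewrite /k; lia.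
exists (cls m (g * theta m k * h)), k => j kj.
have [s [sP [t [tP [si ti ->]]]]] := theta_stable m kj.
have -> : g * (permG sP * theta m k * permG tP) * h =
          permG sP * (g * theta m k * h) * permG tP.
  rewrite !mulgA (perm_commute sP gk si).
  by rewrite -(mulgA _ (permG tP) h) (perm_commute tP hk ti) !mulgA.
by apply: cls_mul => i lt; rewrite /= perm_fun_x ?si ?ti //; lia.
Qed.

(* The eventual value of the sequence of double cosets; the default value     *)
(* cls m 1 is never used, by dcoset_eventually_constant.                      *)
Definition circ (m : nat) (g h : GG) : Gamma m :=
  xget (cls m 1) [set D | exists N, forall j, N <= j ->
    cls m (g * theta m j * h) = D].

Lemma circP m g h : exists N, forall j, N <= j ->
  cls m (g * theta m j * h) = circ m g h.
Proof.
exact: (@xgetPex _ (cls m 1) [set D | exists N, forall j, N <= j ->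
  cls m (g * theta m j * h) = D]) (dcoset_eventually_constant m g h).
Qed.

(* Main.v *)
(** The involution [theta m j] conjugates an element of [HH m], for large [j],
    to one fixing the first [m + j] generators, and conjugating further by an
    element supported on these generators stays inside [HH m].  Hence factors
    from [HH m] adjacent to [theta m j] in [g * theta m j * h] can be moved to
    the outside, which gives (a).  For (b), both bracketings are represented by
    products of [g] with copies of [h] and [k] transported to disjoint blocks of
    generators far away, and a permutation of the blocks matches them. *)

Require Import Defs.
From mathcomp Require Import all_boot zify boolp classical_sets.

Set Implicit Arguments.
Unset Strict Implicit.
Unset Printing Implicit Defensive.

Local Open Scope classical_set_scope.
Local Open Scope group_scope.

Lemma HH_Fn n (c : GG) w : HH n c -> Fn n w -> c w = w.
Proof.
have [_ cM _] := autP c => cn.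
apply: (@generated_sub _ _ [set w | c w = w]); last by move=> _ [i /= lt <-]; exact: cn.
split=> [|v u /= ev eu]; first exact: morph1.
by rewrite cM (morphV cM) ev eu.
Qed.

(** [g^-1] carries each [x_ i] with [i < n] to a word in the first [n] generators, and [c] fixes
    every such word. *)
Lemma HH_conj n (g c : GG) : supported_on n g -> HH n c -> HH n (g * c * g^-1).
Proof.
move=> [gF _] cn i lt; have : Fn n (x_ i) by apply: sub_generated; exists i.
rewrite -gF => -[w Fw e]; rewrite !GG_mulE -{1}e -(GG_mulE g^-1) mulVg.
by rewrite (HH_Fn cn Fw).
Qed.

Lemma HH_le m n (g : GG) : m <= n -> HH n g -> HH m g.
Proof. by move=> le gn i lt; apply: gn; exact: leq_trans le. Qed.

Lemma eventually_supported (g : GG) :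
  exists N, forall n, N <= n -> supported_on n g.
Proof. by have [_ gM [N gN]] := autP g; exists N => n le; exact: supported_le gN. Qed.

Lemma thetaK m j : theta m j * theta m j = 1.
Proof. by apply: GG_ext => i; rewrite GG_mulE /= !perm_fun_x theta_funK. Qed.

(** For [i < m + j], the involution sends [x_ i] to a generator of index below [m] or at least
    [m + j]; [a] fixes the former by membership in [HH m], the latter by its support. *)
Lemma theta_conj m j n (a : GG) : HH m a -> supported_on n a -> n <= m + j ->
  HH (m + j) (theta m j * a * theta m j).
Proof.
move=> am [_ an] le i lt.
suff ax : a (x_ (theta_fun m j i)) = x_ (theta_fun m j i).
  by rewrite !GG_mulE /= perm_fun_x ax perm_fun_x theta_funK.
rewrite /theta_fun lt; case: ltnP => [|ge]; first exact: am.
by apply: an; lia.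
Qed.

Lemma circ_HH m (a g b c h d : GG) : HH m a -> HH m b -> HH m c -> HH m d ->
  circ m (a * g * b) (c * h * d) = circ m g h.
Proof.
move=> Ha Hb Hc Hd.
have [N1 e1] := circP m (a * g * b) (c * h * d).
have [N2 e2] := circP m g h.
have [Nb sb] := eventually_supported b.
have [Nc sc] := eventually_supported c.
have [Ngb sgb] := eventually_supported (g * b).
have [Nh sh] := eventually_supported h^-1.
pose j := N1 + N2 + Nb + Nc + Ngb + Nh.
rewrite -(e1 j); last by rewrite /j; lia.
rewrite -(e2 j); last by rewrite /j; lia.
set t := theta m j.
have tbt : HH (m + j) (t * b * t).
  by apply: (theta_conj Hb (sb Nb _)) => //; rewrite /j; lia.
have tct : HH (m + j) (t * c * t).
  by apply: (theta_conj Hc (sc Nc _)) => //; rewrite /j; lia.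
have c1 : HH m (g * b * (t * c * t) * (g * b)^-1).
  apply: (HH_le (leq_addr j m)); apply: HH_conj tct; apply: sgb.
  by rewrite /j; lia.
have b1 : HH m (h^-1 * (t * b * t) * h).
  rewrite -{2}[h]invgK; apply: (HH_le (leq_addr j m)); apply: HH_conj tbt.
  by apply: sh; rewrite /j; lia.
have tt : forall z, t * (t * z) = z by move=> z; rewrite mulgA thetaK mul1g.
(* [c] moves left past [t] and [g * b], becoming the conjugate in [c1]; then [b] moves right past
   [t] and [h], becoming the one in [b1]. *)
rewrite -(cls_mul (g * t * h) (HHM Ha c1) (HHM b1 Hd)); congr cls.
by rewrite invgM -!mulgA !mulVKg tt !(mulKg, mulVKg) tt.
Qed.

Lemma cls_eq m (g g' : GG) : cls m g = cls m g' ->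
  exists a b, [/\ HH m a, HH m b & g' = a * g * b].
Proof.
move=> /(congr1 (@sval _ _)) /= e.
have : dcoset m g' g' by exists 1 => //; exists 1; rewrite // mul1g mulg1.
by rewrite -e => -[a Ha [b Hb <-]]; exists a, b.
Qed.

Lemma circ_eq m (g g' h h' : GG) :
  cls m g = cls m g' -> cls m h = cls m h' -> circ m g h = circ m g' h'.
Proof.
by move=> /cls_eq [a [b [Ha Hb ->]]] /cls_eq [c [d [Hc Hd ->]]]; rewrite circ_HH.
Qed.

Lemma cls_surj m (D : Gamma m) : exists g, cls m g = D.
Proof.
by case: D => D DP; have [g _ e] := set_mem DP; exists g; exact: val_inj.
Qed.

Lemma finitary_comp s t : finitary s -> finitary t -> finitary (s \o t).
Proof.
move=> [sb [n sn]] [tb [n' tn]]; split; first exact: bij_comp.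
by exists (maxn n n') => i le /=; rewrite tn ?sn //; lia.
Qed.

Local Ltac case_ltn := repeat match goal with
  |- context [leq (S ?a) ?b] =>
    lazymatch a with
    | context [if _ then _ else _] => fail
    | _ => case: (ltnP a b) => ? /=
    end end.

(** With [j] as inner and [i] as outer index, both large, the two sides represent the two
    bracketings of the triple product. *)
Lemma cls_theta_swap m i j (g h k : GG) : j + j <= i ->
  supported_on (m + j) g -> supported_on (m + j) h -> supported_on (m + j) k ->
  cls m (g * theta m j * h * theta m i * k) =
  cls m (g * theta m i * h * theta m j * k).
Proof.
move=> le gs hs ks.
(* p cycles the blocks [m+j, m+2j) -> [m+i, m+i+j) -> [m+i+j, m+i+2j); the
   first two carry h and k on the left-hand side, the last two on the right. *)
pose p r := if r < m + j then r else if r < m + j + j then r + (i - j)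
  else if r < m + i then r else if r < m + i + j then r + j
  else if r < m + i + j + j then r - i else r.
pose q r := if r < m + j then r else if r < m + j + j then r + i
  else if r < m + i then r else if r < m + i + j then r - (i - j)
  else if r < m + i + j + j then r - j else r.
have pq : cancel p q by move=> r; rewrite /p /q; case_ltn; lia.
have qp : cancel q p by move=> r; rewrite /p /q; case_ltn; lia.
have far r : m + i + j + j <= r -> p r = r /\ q r = r.
  by rewrite /p /q; split; case_ltn; lia.
have pP : finitary p.
  by split; [exists q|exists (m + i + j + j) => r /far []].
have qP : finitary q.
  by split; [exists p|exists (m + i + j + j) => r /far []].
(* The permutations u of [uP] and v of [vP] are forced by [ei] and [ev]. Since p, u and v fix all
   indices below [m + j], they commute with [g], [h] and [k] respectively: p escapes to the left,
   while u passes [h], turns into v and escapes to the right. *)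
have uP := finitary_comp (theta_finitary m j) (finitary_comp qP (theta_finitary m i)).
have vP := finitary_comp (theta_finitary m i) (finitary_comp uP (theta_finitary m j)).
have pf r : r < m + j -> p r = r by rewrite /p => ->.
have uf r : r < m + j -> (theta_fun m j \o (q \o theta_fun m i)) r = r.
  by rewrite /= /theta_fun /q; case_ltn; lia.
have vf r : r < m + j -> (theta_fun m i \o
    ((theta_fun m j \o (q \o theta_fun m i)) \o theta_fun m j)) r = r.
  by rewrite /= /theta_fun /q; case_ltn; lia.
have ei : theta m i = permG pP * theta m j * permG uP.
  apply: GG_ext => r; rewrite !GG_mulE /= !perm_fun_x /=.
  by rewrite theta_funK qp.
have ev : permG uP * theta m j = theta m i * permG vP.
  apply: GG_ext => r; rewrite !GG_mulE /= !perm_fun_x /=.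
  by rewrite (theta_funK m i).
have -> : g * theta m i * h * theta m j * k =
    permG pP * (g * theta m j * h * theta m i * k) * permG vP.
  rewrite {1}ei !mulgA (perm_commute pP gs pf) -!mulgA.
  by rewrite (mulgA (permG uP) h) (perm_commute uP hs uf) -(perm_commute vP ks vf)
    -!mulgA (mulgA (permG uP)) ev -!mulgA.
apply/esym/cls_mul => r lt; rewrite /= perm_fun_x ?pf ?vf //; lia.
Qed.

Lemma circ_assoc m (g h k gh hk : GG) :
  cls m gh = circ m g h -> cls m hk = circ m h k ->
  circ m g hk = circ m gh k.
Proof.
move=> egh ehk.
have [N1 e1] := circP m g h; have [N2 e2] := circP m h k.
have [Ng sg] := eventually_supported g.
have [Nh sh] := eventually_supported h.
have [Nk sk] := eventually_supported k.
pose j := N1 + N2 + Ng + Nh + Nk.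
have j1 : N1 <= j by rewrite /j; lia.
have j2 : N2 <= j by rewrite /j; lia.
(* By (a), the given representatives may be replaced by explicit products at stage [j]. *)
rewrite (@circ_eq m g g hk (h * theta m j * k)) ?ehk ?e2 //.
rewrite (@circ_eq m gh (g * theta m j * h) k k) ?egh ?e1 //.
have [N3 e3] := circP m g (h * theta m j * k).
have [N4 e4] := circP m (g * theta m j * h) k.
(* The outer index comes after [j], on which [N3] and [N4] depend; the summand [j + j] keeps the
   blocks disjoint. *)
pose i := N3 + N4 + j + j.
rewrite -(e3 i); last by rewrite /i; lia.
rewrite -(e4 i); last by rewrite /i; lia.
rewrite cls_theta_swap; first by rewrite !mulgA.
- by rewrite /i; lia.
- by apply: sg; rewrite /j; lia.
- by apply: sh; rewrite /j; lia.
- by apply: sk; rewrite /j; lia.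
Qed.

Theorem proposition1p1 (m : nat) (m_gt0 : 0 < m) :
  (forall g g' h h' : GG,
     cls m g = cls m g' -> cls m h = cls m h' -> circ m g h = circ m g' h')
  /\
  (exists op : Gamma m -> Gamma m -> Gamma m,
     (forall g h : GG, op (cls m g) (cls m h) = circ m g h) /\ associative op).
Proof.
split; first exact: circ_eq.
(* The operation is computed on chosen representatives; [circ_eq] makes the choice immaterial. *)
have [rep repK] := choice (@cls_surj m).
exists (fun D E => circ m (rep D) (rep E)); split=> [g h|D E F].
  by apply: circ_eq; rewrite repK.
by apply: circ_assoc; rewrite repK.
Qed.
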